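(* Let $\mathcal{I}$ be an input simplicial model, $\mathcal{T}=\langle T,\sim,\mathsf{pre}\rangle$ a task action model on $\mathcal{I}$, and $\mathcal{P}$ a protocol action model on $\mathcal{I}$. Let $$\phi = \bigwedge_{X\in\mathcal{F}(\mathcal{I})}\Big(\bigwedge_{p\in\mathrm{Ag}}\mathrm{in}_p^{X(p)} \implies \bigvee_{t\in T,\ \mathcal{I},X\models \mathsf{pre}(t)}\ \bigwedge_{p\in\mathrm{Ag}}\mathrm{decide}_p^{t(p)}\Big).$$ Then $\mathcal{T}$ is solvable in $\mathcal{P}$ (i.e. there exists a morphism of simplicial models $\delta:\mathcal{I}[\mathcal{P}]\to\mathcal{I}[\mathcal{T}]$ with $\pi\circ\delta=\pi$) if and only if there exists an extension $\widehat{\mathcal{I}[\mathcal{P}]}$ of $\mathcal{I}[\mathcal{P}]$, assigning a single decision value to each vertex, such that $\phi$ is true in every world (facet) of $\widehat{\mathcal{I}[\mathcal{P}]}$.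
   Context: Simplicial models. Fix a finite set $\mathrm{Ag}$ of agents. A simplicial complex is a family of non-empty finite sets (simplices) closed under non-empty subsets; facets (worlds) are maximal simplices. A chromatic complex has a coloring $\chi$ of vertices by $\mathrm{Ag}$, injective on each simplex. A simplicial model $\langle C,\chi,\ell\rangle$ is a pure chromatic complex of dimension $|\mathrm{Ag}|-1$ with a labeling $\ell$ assigning to each vertex $v$ a set of atomic propositions concerning agent $\chi(v)$; $\ell(X)=\bigcup_{v\in X}\ell(v)$. Formulas are built from atoms by $\neg,\wedge$ (with $\vee,\implies$ as abbreviations) and $K_a$; $\mathcal{M},X\models p$ iff $p\in\ell(X)$, Booleans as usual, $\mathcal{M},X\models K_a\varphi$ iff $\varphi$ holds in every facet $Y$ with $a\in\chi(X\cap Y)$. A morphism of simplicial models is a vertex map sending simplices to simplices and preserving $\chi$ and $\ell$. Action models and product update. An action model $\langle T,\sim,\mathsf{pre}\rangle$: set $T$, equivalence relations $\sim_a$ ($a\in\mathrm{Ag}$), precondition formulas $\mathsf{pre}(t)$. The product update $\mathcal{M}[\mathcal{A}]$ has vertices $(v,E)$ with $v$ a vertex, $E$ a $\sim_{\chi(v)}$-class, such that some facet $X\ni v$ and $t\in E$ satisfy $\mathcal{M},X\models\mathsf{pre}(t)$; its facets are $\{(v,[t]_{\chi(v)}):v\in X\}$ for facets $X$ and actions $t$ with $\mathcal{M},X\models\mathsf{pre}(t)$; $(v,E)$ inherits color and labeling of $v$. The projection is $\pi(v,E)=v$. Input models and tasks. Atomic propositions $\mathrm{in}_a^x$ ($a\in\mathrm{Ag}$,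 $x$ in a set $V^{in}$ of input values). An input model $\mathcal{I}$ is a simplicial model in which each vertex $v$ is labeled by a singleton $\{\mathrm{in}_{\chi(v)}^x\}$; for a facet $X$, $X(p)$ denotes the input value of the $p$-colored vertex of $X$; $\mathcal{F}(\mathcal{I})$ is the set of facets. A task action model $\mathcal{T}=\langle T,\sim,\mathsf{pre}\rangle$ has as actions functions $t:\mathrm{Ag}\to V^{out}$ (output assignments), with $t\sim_a t'$ iff $t(a)=t'(a)$, and preconditions true in one or more facets of $\mathcal{I}$; thus a vertex of $\mathcal{I}[\mathcal{T}]$ is identified with a pair $(v,d)$, $v$ a vertex of $\mathcal{I}$, $d\in V^{out}$. A protocol action model $\mathcal{P}$ is any action model on $\mathcal{I}$. Extensions. With new atoms $\mathrm{decide}_p^d$ ($p\in\mathrm{Ag}$, $d\in V^{out}$), an extension $\widehat{\mathcal{I}[\mathcal{P}]}$ of $\mathcal{I}[\mathcal{P}]$ is the same colored complex with labeling $\widehat\ell(v)=\ell(v)\cup\{\mathrm{decide}_{\chi(v)}^d\}$ for a single choice of $d\in V^{out}$ per vertex $v$.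
   Formalization: Assumed, for both directions: facets of I with the same input values satisfy the same preconditions pre(t) (without this, ''solvable implies φ'' can fail); and F(I), and for each facet X the set of t with I,X ⊨ pre(t), are finite, so that φ is a formula. *)

(* Defs.v *)
From HB Require Import structures.
From Stdlib Require Import RelationClasses.
From mathcomp Require Import all_boot finmap.
From mathcomp Require Import mathcomp_extra boolp classical_sets functions cardinality.

Set Implicit Arguments.
Unset Strict Implicit.
Unset Printing Implicit Defensive.

Local Open Scope classical_set_scope.
Local Open Scope card_scope.

(* [FTrue] is the empty conjunction: it is needed because, when there are no
   atoms, negation and binary conjunction alone generate no formula at all. *)
Inductive form (Ag At : Type) : Type :=
| FTrue
| FAtom of At
| FNeg of form Ag At
| FAnd of form Ag At & form Ag At
| FK of Ag & form Ag At.
Arguments FTrue {Ag At}.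
Arguments FAtom {Ag At}.
Arguments FNeg {Ag At}.
Arguments FAnd {Ag At}.
Arguments FK {Ag At}.

Definition FFalse {Ag At} : form Ag At := FNeg FTrue.
Definition FOr {Ag At} (f g : form Ag At) := FNeg (FAnd (FNeg f) (FNeg g)).
Definition FImp {Ag At} (f g : form Ag At) := FOr (FNeg f) g.

Section SimplicialModels.
Variables (Ag : finType) (At : Type) (owner : At -> Ag) (V : Type).

(* [V] is an ambient type: the vertices are the [v] with [simplex [set v]],
   and [color] and [label] are irrelevant elsewhere.  Dimension d means d + 1
   vertices, so facets of dimension #|Ag| - 1 have exactly #|Ag| vertices. *)
Record smodel := SModel {
  simplex : set (set V);
  color : V -> Ag;
  label : V -> set At;
  simplex_finite : forall S, simplex S -> finite_set S;
  simplex_nonempty : forall S, simplex S -> S !=set0;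
  simplex_sub : forall S S' : set V,
    simplex S -> S' `<=` S -> S' !=set0 -> simplex S';
  color_inj : forall S, simplex S -> {in S &, injective color};
  simplex_pure : forall S, simplex S ->
    (forall S', simplex S' -> S `<=` S' -> S' = S) -> S #= `I_#|Ag|;
  label_owner : forall v, simplex [set v] ->
    forall p, label v p -> owner p = color v
}.

Definition vertex (M : smodel) (v : V) : Prop := simplex M [set v].

Definition facet (M : smodel) (X : set V) : Prop :=
  simplex M X /\ forall Y, simplex M Y -> X `<=` Y -> Y = X.

Definition world (M : smodel) : Type := {X : set V | facet M X}.

HB.instance Definition _ M := gen_eqMixin (world M).
HB.instance Definition _ M := gen_choiceMixin (world M).

Fixpoint sat (M : smodel) (X : world M) (f : form Ag At) : Prop :=
  match f with
  | FTrue => True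
  | FAtom p => (\bigcup_(v in sval X) label M v) p
  | FNeg g => ~ sat X g
  | FAnd g h => sat X g /\ sat X h
  | FK a g => forall Y : world M,
      (color M @` (sval X `&` sval Y)) a -> sat Y g
  end.

End SimplicialModels.

Definition morphism {Ag : finType} {At : Type} {owner : At -> Ag}
    {V V' : Type} (M : smodel owner V) (M' : smodel owner V') (f : V -> V') :=
  [/\ forall S, simplex M S -> simplex M' (f @` S),
      forall v, vertex M v -> color M' (f v) = color M v
    & forall v, vertex M v -> label M' (f v) = label M v].

Record actionModel (Ag At : Type) := ActionModel {
  action :> Type;
  sim : Ag -> action -> action -> Prop;
  sim_equiv : forall a, Equivalence (sim a);
  pre : action -> form Ag At
}.

Definition sim_class {Ag At} (A : actionModel Ag At) (a : Ag) (t : A) : set A :=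
  [set t' | sim a t t'].

Lemma card_sub_eq (T : Type) (n : nat) (A B : set T) :
  A `<=` B -> A #= `I_n -> B #= `I_n -> A = B.
Proof.
elim/Pchoice: T => T in A B *.
move=> sAB cA cB.
have fA : finite_set A by exists n.
have fB : finite_set B by exists n.
apply: fset_set_inj => //; apply/eqP.
rewrite eqEfcard (card_fset_set cA) (card_fset_set cB) leqnn andbT.
by move: sAB; rewrite fset_set_sub.
Qed.

Lemma card_setT_fin (T : finType) : [set: T] #= `I_#|T|.
Proof.
rewrite (card_eqr card_II).
have -> : [set: 'I_#|T|] = enum_rank @` [set: T].
  by apply/seteqP; split=> i // _; exists (enum_val i) => //; rewrite enum_valK.
by apply/card_esym/inj_card_eq => x y _ _; exact: enum_rank_inj.
Qed.

Lemma world_card {Ag : finType} {At : Type} {owner : At -> Ag} {V : Type}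
  (M : smodel owner V) (X : world M) : sval X #= `I_#|Ag|.
Proof. by case: X => X [sX mX] /=; exact: simplex_pure mX. Qed.

Lemma world_color {Ag : finType} {At : Type} {owner : At -> Ag} {V : Type}
    (M : smodel owner V) (X : world M) (a : Ag) :
  exists2 v, sval X v & color M v = a.
Proof.
have : (color M @` sval X) a; last by [].
rewrite (@card_sub_eq _ #|Ag| (color M @` sval X) setT) //.
- apply: card_eq_trans (world_card X).
  by apply/inj_card_eq/color_inj; case: (svalP X).
- exact: card_setT_fin.
Qed.

Lemma world_vertex {Ag : finType} {At : Type} {owner : At -> Ag} {V : Type}
    (M : smodel owner V) (X : world M) (v : V) : sval X v -> vertex M v.
Proof.
case: (svalP X) => sX _ Xv; apply: (simplex_sub sX); last by exists v.
by move=> _ ->.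
Qed.

Section ProductUpdate.
Variables (Ag : finType) (At : Type) (owner : At -> Ag) (V : Type).
Variables (M : smodel owner V) (A : actionModel Ag At).
Implicit Types (S : set (V * set (action A))) (w : V * set (action A)).

Definition update_facet (X : world M) (t : A) : set (V * set (action A)) :=
  (fun v => (v, sim_class (color M v) t)) @` sval X.

Definition update_simplex : set (set (V * set (action A))) :=
  [set S | S !=set0 /\ exists (X : world M) t, sat X (pre t) /\ S `<=` update_facet X t].

Definition update_color w : Ag := color M w.1.
Definition update_label w : set At := label M w.1.

Lemma update_facet_card (X : world M) (t : A) : update_facet X t #= `I_#|Ag|.
Proof.
apply: card_eq_trans (world_card X).
by apply: inj_card_eq => u v _ _ [].
Qed.

Lemma update_finite S : update_simplex S -> finite_set S.
Proof.
move=> [_ [X [t [_ sS]]]]; apply: sub_finite_set sS _.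
by exists #|Ag|; exact: update_facet_card.
Qed.

Lemma update_nonempty S : update_simplex S -> S !=set0.
Proof. by case. Qed.

Lemma update_sub S S' :
  update_simplex S -> S' `<=` S -> S' !=set0 -> update_simplex S'.
Proof.
move=> [_ [X [t [Xt sS]]]] sS' n; split=> //; exists X, t; split=> //.
exact: subset_trans sS.
Qed.

Lemma update_inj S : update_simplex S -> {in S &, injective update_color}.
Proof.
move=> [_ [X [t [Xt sS]]]] w w'; rewrite !inE => /sS[v Xv <-] /sS[v' Xv' <-].
rewrite /update_color /= => e; suff -> : v = v' by [].
case: (svalP X) => sX _; apply: (color_inj sX) => //; exact: mem_set.
Qed.

Lemma update_pure S : update_simplex S ->
  (forall S', update_simplex S' -> S `<=` S' -> S' = S) -> S #= `I_#|Ag|.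
Proof.
move=> [[w Sw] [X [t [Xt sS]]]] mS.
rewrite -(mS (update_facet X t)) //; first exact: update_facet_card.
by split; [exists w; exact: sS | exists X, t; split].
Qed.

Lemma update_owner w : update_simplex [set w] ->
  forall p, update_label w p -> owner p = update_color w.
Proof.
move=> [_ [X [t [Xt sS]]]]; case: (sS w) => // v Xv <- p.
by apply: label_owner; exact: world_vertex Xv.
Qed.

Definition update : smodel owner (V * set (action A)) :=
  SModel update_finite update_nonempty update_sub update_inj update_pure
    update_owner.

Lemma update_vertexP w : vertex update w <->
  exists (X : world M) t, [/\ sval X w.1, sat X (pre t) & w.2 = sim_class (color M w.1) t].
Proof.
split=> [[_ [X [t [Xt sS]]]]|[X [t [Xw Xt ew]]]].
  by exists X, t; case: (sS w) => // v Xv <-.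
split; first by exists w.
exists X, t; split=> // _ ->; exists w.1 => //.
by rewrite -ew -surjective_pairing.
Qed.

Lemma update_facetP S : facet update S <->
  exists (X : world M) t, sat X (pre t) /\ S = update_facet X t.
Proof.
split=> [[sS mS]|[X [t [Xt ->]]]].
  have [[w Sw] [X [t [Xt sSX]]]] := sS.
  exists X, t; split=> //; apply: card_sub_eq sSX _ (update_facet_card X t).
  exact: update_pure.
split=> [|Y sY sXY].
  split; last by exists X, t; split.
  case: (svalP X) => /simplex_nonempty[v Xv] _.
  by exists (v, sim_class (color M v) t); exists v.
have [_ [X' [t' [Xt' sY']]]] := sY.
have e : update_facet X t = update_facet X' t'.
  apply: card_sub_eq (update_facet_card X t) (update_facet_card X' t').
  exact: subset_trans sY'.
by apply/seteqP; split=> //; rewrite e.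
Qed.

End ProductUpdate.

Inductive inAtom (Ag Vin : Type) : Type := In of Ag & Vin.

Definition inOwner {Ag Vin} (p : inAtom Ag Vin) : Ag := let: In a _ := p in a.

Record inputModel (Ag : finType) (Vin V : Type) := InputModel {
  input_smodel :> smodel (@inOwner Ag Vin) V;
  input_label : forall v, vertex input_smodel v ->
    exists x, label input_smodel v = [set In (color input_smodel v) x]
}.

Lemma input_val_ex {Ag : finType} {Vin V : Type} (I : inputModel Ag Vin V)
    (X : world I) (p : Ag) :
  exists x v, [/\ sval X v, color I v = p & label I v = [set In p x]].
Proof.
have [v Xv cv] := world_color X p.
have [x lx] := input_label (world_vertex Xv).
by exists x, v; rewrite -cv.
Qed.

Definition input_val {Ag : finType} {Vin V : Type} {I : inputModel Ag Vin V}
  (X : world I) (p : Ag) : Vin := projT1 (cid (input_val_ex X p)).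

Definition taskAction {Ag Vout : Type} (T : set (Ag -> Vout)) : Type :=
  {t : Ag -> Vout | T t}.

HB.instance Definition _ (Ag Vout : Type) (T : set (Ag -> Vout)) :=
  gen_eqMixin (taskAction T).
HB.instance Definition _ (Ag Vout : Type) (T : set (Ag -> Vout)) :=
  gen_choiceMixin (taskAction T).

Record taskModel {Ag : finType} {Vin V : Type} (Vout : Type)
    (I : inputModel Ag Vin V) := TaskModel {
  task_set : set (Ag -> Vout);
  task_pre : taskAction task_set -> form Ag (inAtom Ag Vin);
  task_preP : forall t, exists X : world I, sat X (task_pre t)
}.

Section Task.
Variables (Ag : finType) (Vin Vout V : Type) (I : inputModel Ag Vin V).
Variable T : taskModel Vout I.

Definition task_sim (a : Ag) (t t' : taskAction (task_set T)) : Prop :=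
  sval t a = sval t' a.

Lemma task_sim_equiv a : Equivalence (task_sim a).
Proof. by split=> [x|x y|x y z]; rewrite /task_sim // => -> ->. Qed.

Definition task_action : actionModel Ag (inAtom Ag Vin) :=
  ActionModel task_sim_equiv (@task_pre _ _ _ _ _ T).

Definition legal (X : world I) : set (taskAction (task_set T)) :=
  [set t | sat X (task_pre t)].

Definition solvable (P : actionModel Ag (inAtom Ag Vin)) : Prop :=
  exists delta, morphism (update I P) (update I task_action) delta /\
    forall w, vertex (update I P) w -> (delta w).1 = w.1.

End Task.
Arguments legal {Ag Vin Vout V I}.
Arguments solvable {Ag Vin Vout V I}.

Inductive extAtom (Ag Vin Vout : Type) : Type :=
| Base of inAtom Ag Vin
| Decide of Ag & Vout.
Arguments Base {Ag Vin Vout}.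
Arguments Decide {Ag Vin Vout}.

Definition extOwner {Ag Vin Vout} (q : extAtom Ag Vin Vout) : Ag :=
  match q with Base p => inOwner p | Decide a _ => a end.

Definition extension {Ag : finType} {Vin Vout V : Type}
    (M : smodel (@inOwner Ag Vin) V) (M' : smodel (@extOwner Ag Vin Vout) V) :=
  [/\ simplex M' = simplex M,
      forall v, vertex M v -> color M' v = color M v
    & forall v, vertex M v -> exists d,
        label M' v = Base @` label M v `|` [set Decide (color M v) d]].

(* [fset_set] is empty on infinite sets, so this is the intended formula only
   when I has finitely many facets and [legal T X] is finite for every X: the
   language has finite conjunctions and disjunctions only. *)
Definition task_formula {Ag : finType} {Vin Vout V : Type}
    {I : inputModel Ag Vin V} (T : taskModel Vout I) :
    form Ag (extAtom Ag Vin Vout) :=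
  \big[FAnd/FTrue]_(X <- fset_set [set: world I])
    FImp (\big[FAnd/FTrue]_(p : Ag) FAtom (Base (In p (input_val X p))))
      (\big[FOr/FFalse]_(t <- fset_set (legal T X))
         \big[FAnd/FTrue]_(p : Ag) FAtom (Decide p (sval t p))).

(* Legality of an output depends on the input values only.  This holds if a
   facet is determined by its input values, in particular if vertices are pairs
   (agent, input value), and also if preconditions are Boolean (K-free).
   It is needed because the guard of the X-conjunct of [task_formula] is true in
   every facet with the same input values as X, whereas preconditions can
   distinguish such facets.  Take agents a, b and facets X = {u, v}, Y = {u, w},
   X' = {u', v'}, with u, u' labeled in_a^0, v, v' labeled in_b^0, w labeled
   in_b^1; let the output constant 0 have precondition ~ K_a in_b^0 (true in X
   and Y only), the output constant 1 have precondition K_a in_b^0 (true in X'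
   only), and the protocol be a single action with precondition true.  The task
   is solvable, but the conjuncts of X and X' ask for different decisions in
   X. *)
Definition input_determined {Ag : finType} {Vin Vout V : Type}
    {I : inputModel Ag Vin V} (T : taskModel Vout I) : Prop :=
  forall X X' : world I, input_val X =1 input_val X' -> legal T X = legal T X'.

Lemma facet_input_determined {Ag : finType} {Vin Vout V : Type}
    {I : inputModel Ag Vin V} (T : taskModel Vout I) :
  (forall X X' : world I, input_val X =1 input_val X' -> X = X') ->
  input_determined T.
Proof. by move=> inj X X' /inj ->. Qed.

(* Main.v *)
(** A facet of the protocol model lies over a single facet [X] of [I], and its
    vertices carry the colors and input values of those of [X].  A morphism
    [delta] over the projection maps it into a task facet over the same [X],
    hence given by one action [t] legal at [X]: writing [t a] on the [a]-colored
    vertex turns [delta] into decisions, and conversely decision values turn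
    into classes of task actions.  The conjunct of the formula at [X] says that
    the decisions on the facet come from a single legal action, and
    [input_determined] transfers this to all conjuncts whose guard holds. *)
Require Import Defs.
From mathcomp Require Import all_boot.
From mathcomp Require Import boolp classical_sets functions cardinality.

Set Implicit Arguments.
Unset Strict Implicit.

Local Open Scope classical_set_scope.

(** * Truth of implications and of iterated conjunctions and disjunctions *)

Section BigSat.
Variables (Ag : finType) (At : Type) (owner : At -> Ag) (V : Type).
Variables (M : smodel owner V) (W : world M).

Lemma sat_imp (f g : form Ag At) : sat W (FImp f g) <-> (sat W f -> sat W g).
Proof.
split=> /= [fg Wf|fg [Wf Wg]]; last by apply: Wf => Wf; exact: Wg (fg Wf).
(* Implication is encoded by negation and conjunction, so this direction is classical. *)
by apply: contrapT => Wg; apply: fg; split=> //; exact.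
Qed.

Lemma sat_bigAnd (J : eqType) (r : seq J) (F : J -> form Ag At) :
  sat W (\big[FAnd/FTrue]_(j <- r) F j) <-> forall j, j \in r -> sat W (F j).
Proof.
elim: r => [|i r IH]; first by rewrite big_nil.
rewrite big_cons /=; split=> [[Wi /IH Wr] j|Wr].
  by rewrite inE => /predU1P[-> //|]; exact: Wr.
split; first by apply: Wr; rewrite mem_head.
by apply/IH => j rj; apply: Wr; rewrite inE rj orbT.
Qed.

Lemma sat_bigOr (J : eqType) (r : seq J) (F : J -> form Ag At) :
  sat W (\big[FOr/FFalse]_(j <- r) F j) <-> exists2 j, j \in r & sat W (F j).
Proof.
elim: r => [|i r IH]; first by rewrite big_nil; split=> [|[]//]; case.
rewrite big_cons /=; split=> [Wor|[j + Wj] [Wi Wr]].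
  apply: contrapT => nr; apply: Wor; split=> [Wi|/IH[j rj Wj]]; apply: nr.
    by exists i; rewrite ?mem_head.
  by exists j; rewrite // inE rj orbT.
rewrite inE => /predU1P[ji|rj]; first by apply: Wi; rewrite -ji.
by apply: Wr; apply/IH; exists j.
Qed.

Lemma sat_bigAnd_fin (J : finType) (F : J -> form Ag At) :
  sat W (\big[FAnd/FTrue]_(j : J) F j) <-> forall j, sat W (F j).
Proof.
split=> [/sat_bigAnd WF j|WF]; last by apply/sat_bigAnd.
by apply: WF; exact: mem_index_enum.
Qed.

End BigSat.

(** * Vertices and input values of a world *)

Lemma world_color_inj {Ag : finType} {At : Type} {owner : At -> Ag} {V : Type}
    {M : smodel owner V} (X : world M) (u v : V) :
  sval X u -> sval X v -> color M u = color M v -> u = v.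
Proof.
case: (svalP X) => sX _ Xu Xv; apply: (color_inj sX); exact: mem_set.
Qed.

(** All worlds have [#|Ag|] vertices, so none lies properly inside another. *)
Lemma world_sub_eq {Ag : finType} {At : Type} {owner : At -> Ag} {V : Type}
    {M : smodel owner V} (X Y : world M) : sval X `<=` sval Y -> X = Y.
Proof.
move=> sXY; have eXY := card_sub_eq sXY (world_card X) (world_card Y).
by case: X Y {sXY} eXY => [X fX] [Y fY] /= XY; exact: eq_exist.
Qed.

(** The vertex chosen inside [input_val] has the color of [v], hence is [v]. *)
Lemma input_valP {Ag : finType} {Vin V : Type} {I : inputModel Ag Vin V}
    (X : world I) (v : V) : sval X v ->
  label I v = [set In (color I v) (input_val X (color I v))].
Proof.
move=> Xv; rewrite /input_val; case: cid => x [u [Xu cu lu]] /=.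
by rewrite -lu (world_color_inj Xv Xu).
Qed.

(** Finiteness makes [fset_set] list exactly the facets and the legal actions, so the connectives
    become quantifiers. *)
Lemma sat_task_formula {Ag : finType} {Vin Vout V V' : Type}
    {I : inputModel Ag Vin V} {T : taskModel Vout I}
    {M : smodel (@extOwner Ag Vin Vout) V'} (W : world M)
    (facets_finite : finite_set [set: world I])
    (legal_finite : forall X : world I, finite_set (legal T X)) :
  sat W (task_formula T) <->
  forall X : world I,
    (forall p, sat W (FAtom (Base (In p (input_val X p))))) ->
    exists2 t, legal T X t & forall p, sat W (FAtom (Decide p (sval t p))).
Proof.
split=> [/sat_bigAnd Wphi X WX|Wphi].
  have := Wphi X; rewrite in_fset_set // in_setT => /(_ isT)/sat_imp WXt.
  have [|t] := (sat_bigOr _ _ _).1 (WXt _); first exact/sat_bigAnd_fin.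
  by rewrite in_fset_set // => /set_mem Xt /sat_bigAnd_fin; exists t.
apply/sat_bigAnd => X _; apply/sat_imp => /sat_bigAnd_fin /Wphi[t Xt Wt].
apply/sat_bigOr; exists t; first by rewrite in_fset_set // mem_set.
exact/sat_bigAnd_fin.
Qed.

(** * Labels in an extension of the protocol model *)

Section Extension.
Variables (Ag : finType) (Vin Vout V : Type) (I : inputModel Ag Vin V).
Variables (P : actionModel Ag (inAtom Ag Vin)).
Variables (M : smodel (@extOwner Ag Vin Vout) (V * set (action P))).
Hypothesis extM : extension (update I P) M.

Lemma ext_facet S : facet M S <-> facet (update I P) S.
Proof. by case: extM => eM _ _; rewrite /facet eM. Qed.

Lemma ext_label_base w q : vertex (update I P) w ->
  label M w (Base q) <-> label I w.1 q.
Proof.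
case: extM => _ _ lM /lM[d ->]; split=> [[[_ lq [<-]]|]//|lq].
by left; exists q.
Qed.

(** An extension adds a single decision atom to each vertex. *)
Lemma ext_label_decide w a d d' : vertex (update I P) w ->
  label M w (Decide (color I w.1) d) ->
  label M w (Decide a d') <-> a = color I w.1 /\ d' = d.
Proof.
case: extM => _ _ lM /lM[e ->].
case=> [[]//|[->]]; split=> [[[]//|[-> ->]]|[-> ->]] //; by right.
Qed.

Lemma ext_label_decide_color w a d : vertex (update I P) w ->
  label M w (Decide a d) -> a = color I w.1.
Proof. by case: extM => _ _ lM /lM[e ->] [[]//|[->]]. Qed.

Lemma update_facet_vertex (X : world I) (s : P) (v : V) :
  sat X (pre s) -> sval X v ->
  vertex (update I P) (v, sim_class (color I v) s).
Proof. by move=> Xs Xv; apply/update_vertexP; exists X, s. Qed.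

(** Consequently, the guard of another facet holds in [W] only if that facet has the input values of
    [X]. *)
Lemma ext_sat_input (W : world M) (X : world I) (s : P) p x :
  sat X (pre s) -> sval W = update_facet X s ->
  sat W (FAtom (Base (In p x))) <-> x = input_val X p.
Proof.
move=> Xs eW /=; rewrite eW; split=> [[_ [v Xv <-]]|->].
  move/(ext_label_base _ (update_facet_vertex Xs Xv)) => /=.
  by rewrite (input_valP Xv) => -[-> ->].
have [v Xv <-] := world_color X p.
exists (v, sim_class (color I v) s); first by exists v.
by apply/(ext_label_base _ (update_facet_vertex Xs Xv)); rewrite (input_valP Xv).
Qed.

(** Only a vertex of color [p] can carry a decision of [p], and [X] has exactly one such vertex, so
    agents and vertices are interchangeable. *)
Lemma ext_sat_decide (W : world M) (X : world I) (s : P) (t : Ag -> Vout) :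
  sat X (pre s) -> sval W = update_facet X s ->
  (forall p, sat W (FAtom (Decide p (t p)))) <->
  (forall v, sval X v ->
    label M (v, sim_class (color I v) s) (Decide (color I v) (t (color I v)))).
Proof.
move=> Xs eW /=; rewrite eW; split=> [Wt v Xv|Xt p].
  have [_ [u Xu <-] lu] := Wt (color I v).
  have vu := ext_label_decide_color (update_facet_vertex Xs Xu) lu.
  by move: lu; rewrite -(world_color_inj Xv Xu vu).
have [v Xv <-] := world_color X p.
by exists (v, sim_class (color I v) s); [exists v | exact: Xt].
Qed.

End Extension.

(** * From a morphism to decision values *)

Section DecisionModel.
Variables (Ag : finType) (Vin Vout V : Type) (I : inputModel Ag Vin V).
Variables (T : taskModel Vout I) (P : actionModel Ag (inAtom Ag Vin)).
Variable delta : V * set (action P) -> V * set (action (task_action T)).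

(* Relational, so that no default decision is needed outside the vertices. *)
Definition decision_label (w : V * set (action P)) : set (extAtom Ag Vin Vout) :=
  Base @` label I w.1 `|`
  [set Decide (color I w.1) (sval t (color I w.1)) | t in
    [set t : task_action T | (delta w).2 = sim_class (color I w.1) t]].

Lemma decision_label_owner w : simplex (update I P) [set w] ->
  forall q, decision_label w q -> extOwner q = color (update I P) w.
Proof.
move=> sw q [[p lp <-]|[t _ <-]] //=.
exact: (@label_owner _ _ _ _ (update I P) w).
Qed.

Definition decision_model : smodel (@extOwner Ag Vin Vout) (V * set (action P)) :=
  SModel (@simplex_finite _ _ _ _ (update I P))
    (@simplex_nonempty _ _ _ _ (update I P))
    (@simplex_sub _ _ _ _ (update I P)) (@color_inj _ _ _ _ (update I P))
    (@simplex_pure _ _ _ _ (update I P)) decision_label_owner.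

Hypothesis mdelta : morphism (update I P) (update I (task_action T)) delta.
Hypothesis pdelta : forall w, vertex (update I P) w -> (delta w).1 = w.1.

(** The second component of [delta w] is a class of task actions that agree at the color of [w];
    their common value is the one decision added. *)
Lemma decision_extension : extension (update I P) decision_model.
Proof.
split=> // w vw; have [sd _ _] := mdelta.
have : vertex (update I (task_action T)) (delta w).
  by have := sd _ vw; rewrite image_set1.
move=> /update_vertexP[X [t [_ _]]]; rewrite pdelta // => dw.
exists (sval t (color I w.1)); congr (_ `|` _).
apply/seteqP; split=> [_ [t' + <-]|_ ->]; last by exists t.
rewrite /= dw => tt'.
(* By reflexivity [t'] lies in its own class, which is that of [t]. *)
have : sim_class (color I w.1) t' t' by [].
by rewrite -tt' /sim_class /= /task_sim => ->.
Qed.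

Lemma delta_facet (X : world I) (s : P) : sat X (pre s) ->
  exists2 t : task_action T, legal T X t &
    delta @` update_facet X s `<=` update_facet X t.
Proof.
move=> Xs; have [sd _ _] := mdelta.
have /sd[_ [Y [t [Yt sY]]]] : simplex (update I P) (update_facet X s).
  have [] // : facet (update I P) (update_facet X s).
  by apply/update_facetP; exists X, s.
(* Since [delta] preserves first components, every vertex of [X] is one of [Y]. *)
suff YX : Y = X by rewrite YX in Yt sY; exists t.
apply/esym/world_sub_eq => v Xv.
pose w := (v, sim_class (color I v) s).
have [u Yu du] : update_facet Y t (delta w).
  by apply: sY; exists w => //; exists v.
by have := pdelta (update_facet_vertex Xs Xv); rewrite -/w -du /= => <-.
Qed.

End DecisionModel.

(** * From decision values to a morphism *)

Section DecisionMap.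
Variables (Ag : finType) (Vin Vout V : Type) (I : inputModel Ag Vin V).
Variables (T : taskModel Vout I) (P : actionModel Ag (inAtom Ag Vin)).
Variables (M : smodel (@extOwner Ag Vin Vout) (V * set (action P))).

Definition decision_map (w : V * set (action P)) :
    V * set (action (task_action T)) :=
  (w.1, [set t : task_action T |
          label M w (Decide (color I w.1) (sval t (color I w.1)))]).

Hypothesis extM : extension (update I P) M.
Hypothesis legalM : forall (X : world I) (s : P), sat X (pre s) ->
  exists2 t, legal T X t & forall v, sval X v ->
    label M (v, sim_class (color I v) s) (Decide (color I v) (sval t (color I v))).

Lemma decision_map_morphism :
  morphism (update I P) (update I (task_action T)) decision_map.
Proof.
split=> // S [[w Sw] [X [s [Xs sS]]]]; split; first by exists (decision_map w), w.
have [t Xt lt] := legalM Xs.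
exists X, t; split=> // _ [w' /sS[v Xv <-] <-]; exists v => //.
congr (_, _); apply/seteqP; rewrite /sim_class /= /task_sim.
(* Uniqueness of the decision at this vertex makes the set in [decision_map] the class of [t]. *)
have dP d' := ext_label_decide extM (color I v) d'
  (update_facet_vertex Xs Xv) (lt _ Xv).
by split=> t' /= => [tt'|/dP[_ ->]] //; apply/dP.
Qed.

End DecisionMap.

Unset Implicit Arguments.

Theorem theorem3 (Ag : finType) (Vin Vout V : Type) (I : inputModel Ag Vin V)
    (T : taskModel Vout I) (P : actionModel Ag (inAtom Ag Vin))
    (facets_finite : finite_set [set: world I])
    (legal_finite : forall X : world I, finite_set (legal T X))
    (inputT : input_determined T) :
  solvable T P <->
  exists M : smodel (@extOwner Ag Vin Vout) (V * set (action P)),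
    extension (update I P) M /\
    forall W : world M, sat W (task_formula T).
Proof.
split=> [[delta [mdelta pdelta]]|[M [extM phiM]]].
  have extM := decision_extension mdelta pdelta.
  exists (decision_model delta); split=> // W.
  apply/sat_task_formula => // X0 WX0.
  have /update_facetP[X [s [Xs eW]]] := (ext_facet extM _).1 (svalP W).
  (* The guard of [X0] holds in [W], which lies over [X], so both facets have the same input
     values. *)
  have -> : legal T X0 = legal T X.
    by apply: inputT => p; apply/(ext_sat_input extM _ _ Xs eW)/WX0.
  have [t Xt dt] := delta_facet mdelta pdelta Xs.
  exists t => //; apply/(ext_sat_decide extM _ Xs eW) => v Xv.
  right; exists t => //=.
  (* The image is the vertex of the task facet of [t] over some [u]; the projection forces [u] to be
     [v]. *)
  have [|u Xu] := dt (delta (v, sim_class (color I v) s)).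
    by exists (v, sim_class (color I v) s) => //; exists v.
  move=> du; have := pdelta _ (update_facet_vertex Xs Xv).
  by rewrite -du /= => ->.
exists (decision_map T M); split=> //; apply: decision_map_morphism => // X s Xs.
have fW : facet M (update_facet X s).
  by apply/(ext_facet extM)/update_facetP; exists X, s.
pose W : world M := exist _ _ fW.
(* The conjunct at [X] itself is used: its guard holds in the facet of [s] over [X]. *)
have [|t Xt Wt] := (sat_task_formula W facets_finite legal_finite).1 (phiM W) X.
  by move=> p; apply/(ext_sat_input extM (W := W) _ _ Xs).
by exists t => //; apply/(ext_sat_decide extM (W := W) (sval t) Xs).
Qed.
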